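(* There exists a finitely generated residually finite group that has computable finite quotients (CFQ) but has unsolvable word problem.
   Context: Let $G$ be a group generated by a finite set $S$. A marked finite group is a pair $(F,f)$ with $F$ a finite group (given by its multiplication table) and $f:S\to F$ a function. $G$ has CFQ (computable finite quotients) if there is an algorithm which, given $(F,f)$, decides whether $f$ extends to a group homomorphism $G\to F$. This property does not depend on the choice of the finite generating set $S$. *)

(* Defs.v *)
From mathcomp Require Import all_boot all_fingroup.
Set Implicit Arguments. Unset Strict Implicit. Unset Printing Implicit Defensive.

(* Arguments are passed as a list; missing arguments read as 0.         *)
Inductive rf : Type :=
| rf_zero : rf
| rf_succ : rf
| rf_proj : nat -> rf
| rf_comp : rf -> list rf -> rf
| rf_prec : rf -> rf -> rf
| rf_min  : rf -> rf.

Inductive rf_eval : rf -> seq nat -> nat -> Prop :=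
| ev_zero xs : rf_eval rf_zero xs 0
| ev_succ xs : rf_eval rf_succ xs (nth 0 xs 0).+1
| ev_proj i xs : rf_eval (rf_proj i) xs (nth 0 xs i)
| ev_comp f gs xs ys y :
    rf_evals gs xs ys -> rf_eval f ys y -> rf_eval (rf_comp f gs) xs y
| ev_prec0 f g xs y :
    rf_eval f xs y -> rf_eval (rf_prec f g) (0 :: xs) y
| ev_precS f g n xs z y :
    rf_eval (rf_prec f g) (n :: xs) z -> rf_eval g (n :: z :: xs) y ->
    rf_eval (rf_prec f g) (n.+1 :: xs) y
| ev_min f xs n :
    rf_eval f (n :: xs) 0 ->
    (forall m, m < n -> exists k, rf_eval f (m :: xs) k.+1) ->
    rf_eval (rf_min f) xs n
with rf_evals : list rf -> seq nat -> seq nat -> Prop :=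
| evs_nil xs : rf_evals nil xs [::]
| evs_cons g gs xs y ys :
    rf_eval g xs y -> rf_evals gs xs ys -> rf_evals (g :: gs) xs (y :: ys).

Definition decides_on (Dom P : nat -> Prop) (e : rf) : Prop :=
  forall n, Dom n -> (P n -> rf_eval e [:: n] 0) /\ (~ P n -> rf_eval e [:: n] 1).

Definition cantor_pair (x y : nat) : nat := ((x + y) * (x + y).+1) %/ 2 + y.

Fixpoint code_list (l : seq nat) : nat :=
  match l with
  | [::] => 0
  | x :: l' => (cantor_pair x (code_list l')).+1
  end.

Record abs_group := AbsGroup {
  gcar :> Type;
  gmul : gcar -> gcar -> gcar;
  gone : gcar;
  ginv : gcar -> gcar;
  gmulA : forall x y z, gmul x (gmul y z) = gmul (gmul x y) z;
  gmul1 : forall x, gmul gone x = x;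
  gmulV : forall x, gmul (ginv x) x = gone }.

(* Words over a marked generating family s 0, ..., s (d-1): a word is a list
   of letters; letter l stands for s (l./2) if l is even and for its inverse
   if l is odd.  A word is valid when all its letters are < 2d. *)
Definition valid_word (d : nat) (w : seq nat) : Prop := all (fun l => l < d.*2) w.

Definition letter_val (G : abs_group) (s : nat -> G) (l : nat) : G :=
  if odd l then ginv (s l./2) else s l./2.

Definition word_val (G : abs_group) (s : nat -> G) (w : seq nat) : G :=
  foldr (fun l acc => gmul (letter_val s l) acc) (gone G) w.

Definition generates (G : abs_group) (d : nat) (s : nat -> G) : Prop :=
  forall g : G, exists w, valid_word d w /\ word_val s w = g.

Definition residually_finite (G : abs_group) : Prop :=
  forall g : G, g <> gone G ->
    exists (gT : finGroupType) (phi : G -> gT),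
      (forall x y, phi (gmul x y) = (phi x * phi y)%g) /\ phi g <> 1%g.

Definition WP_solvable (G : abs_group) (d : nat) (s : nat -> G) : Prop :=
  exists e : rf,
    decides_on (fun n => exists w, valid_word d w /\ n = code_list w)
               (fun n => exists w, valid_word d w /\ n = code_list w
                                   /\ word_val s w = gone G) e.

Definition group_table (n : nat) (T : nat -> nat -> nat) : Prop :=
  [/\ (forall a b, a < n -> b < n -> T a b < n),
      (forall a b c, a < n -> b < n -> c < n -> T a (T b c) = T (T a b) c)
    & exists2 e, e < n &
        (forall a, a < n -> T e a = a /\ T a e = a) /\
        (forall a, a < n -> exists2 b, b < n & T b a = e /\ T a b = e)].

Definition table_of (n : nat) (tbl : seq nat) : nat -> nat -> nat :=
  fun a b => nth 0 tbl (a * n + b).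

(* A marked finite abs_group (F, f): F of order n with table tbl, and f sends
   generator i (i < d) to element nth 0 fl i of F. *)
Definition marked_finite_group (d n : nat) (tbl fl : seq nat) : Prop :=
  [/\ size tbl = n * n, size fl = d, all (fun x => x < n) fl
    & group_table n (table_of n tbl)].

Definition extends_to_hom (G : abs_group) (d : nat) (s : nat -> G)
    (n : nat) (tbl fl : seq nat) : Prop :=
  exists phi : G -> nat,
    [/\ forall g, phi g < n,
        forall x y, phi (gmul x y) = table_of n tbl (phi x) (phi y)
      & forall i, i < d -> phi (s i) = nth 0 fl i].

Definition code_marked (n : nat) (tbl fl : seq nat) : nat :=
  code_list [:: n; code_list tbl; code_list fl].

Definition CFQ (G : abs_group) (d : nat) (s : nat -> G) : Prop :=
  exists e : rf,
    decides_on (fun m => exists n tbl fl,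
                    marked_finite_group d n tbl fl /\ m = code_marked n tbl fl)
               (fun m => exists n tbl fl,
                    [/\ marked_finite_group d n tbl fl, m = code_marked n tbl fl
                      & extends_to_hom d s n tbl fl]) e.

(* Main.v *)
Require Import Defs.
From Stdlib Require Import Classical FunctionalExtensionality ProofIrrelevance.
From mathcomp Require Import all_boot all_fingroup cyclic zify.
Set Implicit Arguments. Unset Strict Implicit. Unset Printing Implicit Defensive.

(* The group is generated by a pair (a, t) in the product of all symmetric groups
   marked by a "tame" pair of permutations, that is, one satisfying the relations
   [a, a^(t^k)] = 1 for k in a set A of exponents; it is therefore residually finite.
   Each machine c contributes one exponent to A: (c+1)! if c does not halt, and
   (c+1)! + (c+s+2)! if it halts at stage s.
   A finite group of order n embeds in S_n, where t^(n!) = 1, so only the machines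
   c < n matter there, and for these only the stages s < n: the relations
   can be checked, and the finite quotients are computable.
   If c halts at stage s, then in the symmetric group on (c+s+5)! points the
   transposition (0 (c+1)!) and the long cycle form a tame pair that violates the
   relation for k = (c+1)!. Hence [a, a^(t^(c+1)!)] = 1 in the group iff c does not
   halt, and the word problem decides the halting problem. *)

(** * Closure properties of computable functions *)

(** The argument list serves as a context of [n] variables, so that closure properties can be
    applied under binders by pushing new entries in front. *)
Definition computable (n : nat) (F : seq nat -> nat) : Prop :=
  exists e, forall xs, size xs = n -> rf_eval e xs (F xs).

Lemma computable_ext n F F' :
  (forall xs, size xs = n -> F xs = F' xs) -> computable n F' -> computable n F.
Proof. by move=> eqF [e he]; exists e => xs sz; rewrite eqF //; apply: he. Qed.

(** For an explicit list [Gs] the [foldr] unfolds to a conjunction with one goal per argument. *)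
Lemma computable_apply n k F (Gs : seq (seq nat -> nat)) :
  size Gs = k -> computable k F -> foldr (fun G Q => computable n G /\ Q) True Gs ->
  computable n (fun xs => F [seq G xs | G <- Gs]).
Proof.
move=> szG [e he] hGs.
have [es hes] : exists es, forall xs, size xs = n ->
    rf_evals es xs [seq G xs | G <- Gs].
  elim: Gs hGs {szG} => [_|G Gs IH [[g hg] /IH[es hes]]] /=.
    by exists nil => xs _; constructor.
  by exists (g :: es) => xs sz; constructor; [apply: hg | apply: hes].
exists (rf_comp e es) => xs sz; apply: ev_comp (hes _ sz) _.
by apply: he; rewrite size_map.
Qed.

Definition computable1 (f : nat -> nat) := computable 1 (fun l => f (nth 0 l 0)).
Definition computable2 (f : nat -> nat -> nat) :=
  computable 2 (fun l => f (nth 0 l 0) (nth 0 l 1)).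
Definition computable4 (f : nat -> nat -> nat -> nat -> nat) :=
  computable 4 (fun l => f (nth 0 l 0) (nth 0 l 1) (nth 0 l 2) (nth 0 l 3)).

Lemma computable_app1 n f A :
  computable1 f -> computable n A -> computable n (fun l => f (A l)).
Proof. by move=> hf hA; apply: (computable_apply (Gs := [:: A])) hf _. Qed.

Lemma computable_app2 n f A B :
  computable2 f -> computable n A -> computable n B ->
  computable n (fun l => f (A l) (B l)).
Proof. by move=> hf hA hB; apply: (computable_apply (Gs := [:: A; B])) hf _. Qed.

Lemma computable_app4 n f A B C D :
  computable4 f -> computable n A -> computable n B -> computable n C ->
  computable n D -> computable n (fun l => f (A l) (B l) (C l) (D l)).
Proof.
by move=> hf hA hB hC hD; apply: (computable_apply (Gs := [:: A; B; C; D])) hf _.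
Qed.

(* [tail_of k X]: X drops the first k entries; X is how an outer context looks
   from below k binders. *)
Definition tail_of (k : nat) (X : seq nat -> seq nat) := forall l, X l = drop k l.

Lemma tail_of0 : tail_of 0 (fun l => l).
Proof. by move=> l; rewrite drop0. Qed.

Lemma tail_ofS k X : tail_of k X -> tail_of k.+1 (fun l => behead (X l)).
Proof. by move=> hX l; rewrite hX -drop1 drop_drop add1n. Qed.

Lemma computable_var n k X i :
  tail_of k X -> computable n (fun l => nth 0 (X l) i).
Proof.
by move=> hX; exists (rf_proj (k + i)) => xs _; rewrite hX nth_drop; constructor.
Qed.

Lemma computable_const n c : computable n (fun=> c).
Proof.
elim: c => [|c IH]; first by exists rf_zero => xs _; constructor.
have hS : computable1 S by exists rf_succ => xs _; constructor.
exact: computable_app1 hS IH.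
Qed.

Lemma computable_succ n A : computable n A -> computable n (fun l => (A l).+1).
Proof.
move=> hA; have hS : computable1 S by exists rf_succ => xs _; constructor.
exact: computable_app1 hS hA.
Qed.

(** This is primitive recursion: the body sees the index and the accumulator in front of the outer
    context. *)
Lemma computable_iteri n B F G :
  computable n B -> computable n F ->
  computable n.+2 (fun l => G (nth 0 l 0) (nth 0 l 1) (behead (behead l))) ->
  computable n (fun l => iteri (B l) (fun i acc => G i acc l) (F l)).
Proof.
move=> hB [f hf] [g hg].
pose R l := iteri (nth 0 l 0) (fun i acc => G i acc (behead l)) (F (behead l)).
have hR : computable n.+1 R.
  exists (rf_prec f g) => -[|k xs] //= [sz]; rewrite /R /=.
  elim: k => [|k IH] /=; first by constructor; apply: hf.
  by apply: ev_precS IH _; apply: (hg [:: k, _ & xs]) => /=; rewrite sz.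
(* The recursion is called on the bound followed by all the original arguments, which are passed on
   by projections. *)
have := @computable_apply n n.+1 R (B :: [seq (fun l => nth 0 l i) | i <- iota 0 n]) _ hR.
rewrite /= size_map size_iota => /(_ erefl) []; first split=> //.
  elim: (iota 0 n) => //= i s IH; split=> //; exact: computable_var tail_of0.
move=> e he; exists e => xs sz; move: (he xs sz).
rewrite -map_comp /R /=; congr rf_eval.
have -> : [seq nth 0 xs i | i <- iota 0 n] = xs by rewrite -sz -[RHS](mkseq_nth 0).
by [].
Qed.

Lemma computable_iter n B F G :
  computable n B -> computable n F ->
  computable n.+2 (fun l => G (nth 0 l 1) (behead (behead l))) ->
  computable n (fun l => iter (B l) (fun acc => G acc l) (F l)).
Proof.
move=> hB hF hG.
apply: (computable_ext (F' := fun l => iteri (B l) (fun i acc => G acc l) (F l))).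
  by move=> xs _; elim: (B xs) => //= k ->.
exact: (computable_iteri (G := fun _ acc l => G acc l)).
Qed.

Ltac solve_tail := lazymatch goal with
  | |- tail_of _ (fun l => behead _) => apply: tail_ofS; solve_tail
  | |- tail_of _ (@behead _) => exact: (tail_ofS tail_of0)
  | |- _ => exact: tail_of0
  end.

Ltac computability_step := lazymatch goal with
  | |- computable _ (fun l => nth 0 _ _) => eapply computable_var; solve_tail
  | |- computable _ (fun l => S _) => apply: computable_succ
  | |- computable _ (fun l => iteri _ _ _) => apply: computable_iteri
  | |- computable _ (fun l => iter _ _ _) => apply: computable_iter
  | |- computable _ (fun l => ?c) => exact: computable_const
  end; cbv beta.

(** * Arithmetic and Boolean connectives *)

Lemma computable_add : computable2 addn.
Proof.
apply: (computable_ext (F' := fun l => iter (nth 0 l 0) (fun x => x.+1) (nth 0 l 1))).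
  by move=> xs _; rewrite iter_succn addnC.
by repeat computability_step.
Qed.

Lemma computable_mul : computable2 muln.
Proof.
apply: (computable_ext
  (F' := fun l => iter (nth 0 l 0) (fun x => x + nth 0 l 1) 0)).
  by move=> xs _; elim: (nth 0 xs 0) => //= k <-; rewrite mulSn addnC.
by repeat first [computability_step | apply: (computable_app2 computable_add); cbv beta].
Qed.

Lemma computable_pred : computable1 predn.
Proof.
apply: (computable_ext (F' := fun l => iteri (nth 0 l 0) (fun i _ => i) 0)).
  by move=> xs _; case: (nth 0 xs 0).
by repeat computability_step.
Qed.

Lemma computable_sub : computable2 subn.
Proof.
apply: (computable_ext (F' := fun l => iter (nth 0 l 1) predn (nth 0 l 0))).
  by move=> xs _; rewrite iter_predn.
by repeat first [computability_step | apply: (computable_app1 computable_pred); cbv beta].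
Qed.

Lemma computable_eq0 : computable1 (fun x => x == 0).
Proof.
apply: (computable_ext (F' := fun l => iter (nth 0 l 0) (fun=> 0) 1)).
  by move=> xs _; case: (nth 0 xs 0).
by repeat computability_step.
Qed.

Lemma computable_fact : computable1 factorial.
Proof.
apply: (computable_ext
  (F' := fun l => iteri (nth 0 l 0) (fun i acc => i.+1 * acc) 1)).
  by move=> xs _; elim: (nth 0 xs 0) => //= k <-.
by repeat first [computability_step | apply: (computable_app2 computable_mul); cbv beta].
Qed.

Lemma computable_eq n A B : computable n A -> computable n B ->
  computable n (fun l => A l == B l).
Proof.
move=> hA hB; apply: (computable_ext
  (F' := fun l => (A l - B l) + (B l - A l) == 0)).
  by move=> xs _; rewrite addn_eq0 !subn_eq0 eqn_leq.
apply: (computable_app1 computable_eq0); apply: (computable_app2 computable_add);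
  exact: (computable_app2 computable_sub).
Qed.

Lemma computable_negb n (b : seq nat -> bool) :
  computable n b -> computable n (fun l => ~~ b l).
Proof.
move=> hb; apply: (computable_ext (F' := fun l => (b l : nat) == 0)).
  by move=> xs _; case: (b xs).
exact: (computable_app1 computable_eq0).
Qed.

Lemma computable_andb n (b c : seq nat -> bool) :
  computable n b -> computable n c -> computable n (fun l => b l && c l).
Proof.
move=> hb hc; apply: (computable_ext (F' := fun l => b l * c l)).
  by move=> xs _; case: (b xs); case: (c xs).
exact: (computable_app2 computable_mul).
Qed.

Lemma computable_if n (b : seq nat -> bool) A B :
  computable n b -> computable n A -> computable n B ->
  computable n (fun l => if b l then A l else B l).
Proof.
move=> hb hA hB; apply: (computable_ext (F' := fun l => b l * A l + (~~ b l) * B l)).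
  by move=> xs _; case: (b xs); rewrite /= !(mul0n, mul1n, addn0).
by apply: (computable_app2 computable_add); apply: (computable_app2 computable_mul) => //;
  exact: computable_negb.
Qed.

(** Here the coercion to numbers stands outside the conditional. *)
Lemma computable_ifb n (b A B : seq nat -> bool) :
  computable n b -> computable n A -> computable n B ->
  computable n (fun l => if b l then A l else B l).
Proof.
move=> hb hA hB; apply: (computable_ext (F' := fun l => if b l then (A l : nat) else B l)).
  by move=> xs _; case: (b xs).
exact: computable_if.
Qed.

(** * Bounded quantifiers, bounded search and finite sums *)

Lemma computable_all n B (P : nat -> seq nat -> bool) :
  computable n.+2 (fun l => P (nth 0 l 0) (behead (behead l))) -> computable n B ->
  computable n (fun l => all (fun i => P i l) (iota 0 (B l))).
Proof.
move=> hP hB; apply: (computable_ext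
  (F' := fun l => iteri (B l) (fun i acc => P i l * acc) 1)).
  move=> xs _; elim: (B xs) => // k IH; rewrite -addn1 iotaD all_cat addn1 /= -IH.
  by case: all; case: (P k xs).
by repeat first [exact: hB | computability_step | exact: hP
  | apply: (computable_app2 computable_mul)].
Qed.

Lemma computable_has n B (P : nat -> seq nat -> bool) :
  computable n.+2 (fun l => P (nth 0 l 0) (behead (behead l))) -> computable n B ->
  computable n (fun l => has (fun i => P i l) (iota 0 (B l))).
Proof.
move=> hP hB; apply: (computable_ext
  (F' := fun l => ~~ all (fun i => ~~ P i l) (iota 0 (B l)))).
  by move=> xs _; rewrite -has_predC; congr (nat_of_bool _); apply: eq_has => i /=; rewrite negbK.
by apply: computable_negb; apply: computable_all => //; apply: computable_negb.
Qed.

Lemma computable_find n B (P : nat -> seq nat -> bool) :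
  computable n.+2 (fun l => P (nth 0 l 0) (behead (behead l))) -> computable n B ->
  computable n (fun l => find (fun i => P i l) (iota 0 (B l))).
Proof.
move=> hP hB; apply: (computable_ext
  (* The accumulator equals the current index as long as the search has failed; once an index is
     found the two differ and the accumulator is frozen. *)
  (F' := fun l => iteri (B l)
     (fun i acc => if acc == i then (if P i l then i else i.+1) else acc) 0)).
  move=> xs _; elim: (B xs) => // k IH; rewrite -addn1 iotaD find_cat addn1 /= -IH.
  rewrite has_find size_iota.
  have := find_size (P^~ xs) (iota 0 k); rewrite size_iota leq_eqVlt.
  case: eqP => [->|_] /=; last by move=> ->.
  by rewrite ltnn; case: ifP => _; rewrite ?addn0 ?addn1.
apply: computable_iteri => //; first exact: computable_const.
apply: computable_if; first by apply: computable_eq; computability_step.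
  by apply: computable_if; [exact: hP | computability_step | do 2 computability_step].
by computability_step.
Qed.

Lemma computable_sum n B F :
  computable n.+2 (fun l => F (nth 0 l 0) (behead (behead l))) -> computable n B ->
  computable n (fun l => \sum_(0 <= i < B l) F i l).
Proof.
move=> hF hB; apply: (computable_ext
  (F' := fun l => iteri (B l) (fun i acc => F i l + acc) 0)).
  move=> xs _; elim: (B xs) => [|k IH]; first by rewrite big_nil.
  by rewrite big_nat_recr //= -IH addnC.
by repeat first [exact: hB | computability_step | exact: hF
  | apply: (computable_app2 computable_add)].
Qed.

Create HintDb computability.
#[local] Hint Resolve computable_add computable_mul computable_sub computable_pred
  computable_fact : computability.

Ltac computability_app := match goal with
  | |- computable _ (fun l => nat_of_bool (?f (@?A l) (@?B l) (@?C l) (@?D l))) =>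
    apply: (computable_app4 (f := fun x y z t => nat_of_bool (f x y z t)));
      [solve [auto with computability nocore] | | | |]
  | |- computable _ (fun l => nat_of_bool (?f (@?A l) (@?B l))) =>
    apply: (computable_app2 (f := fun x y => nat_of_bool (f x y)));
      [solve [auto with computability nocore] | |]
  | |- computable _ (fun l => nat_of_bool (?f (@?A l))) =>
    apply: (computable_app1 (f := fun x => nat_of_bool (f x)));
      [solve [auto with computability nocore] |]
  | |- computable _ (fun l => ?f (@?A l) (@?B l) (@?C l) (@?D l)) =>
    apply: (computable_app4 (f := f)); [solve [auto with computability nocore] | | | |]
  | |- computable _ (fun l => ?f (@?A l) (@?B l)) =>
    apply: (computable_app2 (f := f)); [solve [auto with computability nocore] | |]
  | |- computable _ (fun l => ?f (@?A l)) =>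
    apply: (computable_app1 (f := f)); [solve [auto with computability nocore] |]
  end.

(** The search is directed by the head operation of the function; applications of named functions
    are closed by the lemmas registered in the hint database. *)
Ltac computability := repeat (cbv beta; first
  [ assumption
  | lazymatch goal with
    | |- computable _ (fun l => nat_of_bool (_ == _)) => apply: computable_eq
    | |- computable _ (fun l => nat_of_bool (~~ _)) => apply: computable_negb
    | |- computable _ (fun l => nat_of_bool (_ && _)) => apply: computable_andb
    | |- computable _ (fun l => nat_of_bool (if _ then _ else _)) => apply: computable_ifb
    | |- computable _ (fun l => if _ then _ else _) => apply: computable_if
    | |- computable _ (fun l => nat_of_bool (all _ (iota 0 _))) => apply: computable_all
    | |- computable _ (fun l => nat_of_bool (has _ (iota 0 _))) => apply: computable_has
    | |- computable _ (fun l => find _ (iota 0 _)) => apply: computable_find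
    | |- computable _ (fun l => \sum_(0 <= i < _) _) => apply: computable_sum
    end
  | computability_step | computability_app ]).

(** * Pairs and lists *)

Arguments cantor_pair : simpl never.

(** The triangular sum avoids the division, which makes both computability and monotonicity
    direct. *)
Lemma cantor_pairE x y : cantor_pair x y = \sum_(0 <= i < (x + y).+1) i + y.
Proof.
rewrite /cantor_pair; congr (_ + _); elim: (x + y) => [|n IH].
  by rewrite big_nat1.
by rewrite big_nat_recr //= -IH; lia.
Qed.

Lemma computable_pair : computable2 cantor_pair.
Proof.
apply: (computable_ext (fun xs _ => cantor_pairE (nth 0 xs 0) (nth 0 xs 1))).
by computability.
Qed.
#[local] Hint Resolve computable_pair : computability.

Lemma cantor_pair_step x y : cantor_pair x y.+1 = (cantor_pair x.+1 y).+1.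
Proof. by rewrite !cantor_pairE addnS addSn addnS. Qed.

Lemma cantor_pair_turn y : cantor_pair y.+1 0 = (cantor_pair 0 y).+1.
Proof. by rewrite !cantor_pairE addn0 add0n big_nat_recr //= addn0 addnS. Qed.

(** Counting walks along the antidiagonals: after (x+1, y) comes (x, y+1), and after (0, y) comes
    (y+1, 0). *)
Lemma cantor_pair_surj p : exists x y, p = cantor_pair x y.
Proof.
elim: p => [|p [[|x] [y ->]]]; first by exists 0, 0.
  by exists y.+1, 0; rewrite cantor_pair_turn.
by exists x, y.+1; rewrite cantor_pair_step.
Qed.

(** Codes on a later antidiagonal are larger, and on a single antidiagonal the second component
    determines the code. *)
Lemma cantor_pair_inj x y x' y' :
  cantor_pair x y = cantor_pair x' y' -> x = x' /\ y = y'.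
Proof.
have lt_sum a b a' b' : a + b < a' + b' -> cantor_pair a b < cantor_pair a' b'.
  move=> lt_ab; rewrite !cantor_pairE.
  have : \sum_(0 <= i < (a + b).+2) i <= \sum_(0 <= i < (a' + b').+1) i.
    elim: (a' + b') lt_ab => // d IH; rewrite ltnS leq_eqVlt => /orP[/eqP<-//|/IH le].
    by apply: leq_trans le _; rewrite [leqRHS]big_nat_recr //= leq_addr.
  by rewrite big_nat_recr //=; lia.
case: (ltngtP (x + y) (x' + y')) => [/lt_sum|/lt_sum|eq_sum]; try lia.
by rewrite !cantor_pairE eq_sum; lia.
Qed.

Lemma leq_cantor_pair x y : x <= cantor_pair x y /\ y <= cantor_pair x y.
Proof.
rewrite cantor_pairE; split; last exact: leq_addl.
by rewrite big_nat_recr //=; lia.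
Qed.

(** The components are at most the code, so a bounded search finds them and is visibly
    computable. *)
Definition pair_fst p :=
  find (fun x => has (fun y => cantor_pair x y == p) (iota 0 p.+1)) (iota 0 p.+1).
Definition pair_snd p :=
  find (fun y => cantor_pair (pair_fst p) y == p) (iota 0 p.+1).

Arguments pair_fst : simpl never.
Arguments pair_snd : simpl never.

Lemma find_iota_unique (P : pred nat) n x :
  x < n -> P x -> (forall y, P y -> y = x) -> find P (iota 0 n) = x.
Proof.
move=> lt_xn Px uP.
have hP : has P (iota 0 n) by apply/hasP; exists x; rewrite ?mem_iota.
have := nth_find 0 hP; rewrite nth_iota ?add0n; first exact: uP.
by rewrite -[ltnRHS](size_iota 0) -has_find.
Qed.

Lemma pair_fstK x y : pair_fst (cantor_pair x y) = x.
Proof.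
have [le_x le_y] := leq_cantor_pair x y.
apply: find_iota_unique => // [|x' /hasP[y' _ /eqP/cantor_pair_inj[]//]].
by apply/hasP; exists y; rewrite // mem_iota add0n ltnS.
Qed.

Lemma pair_sndK x y : pair_snd (cantor_pair x y) = y.
Proof.
have [le_x le_y] := leq_cantor_pair x y; rewrite /pair_snd pair_fstK.
by apply: find_iota_unique => // y' /eqP/cantor_pair_inj[].
Qed.

Lemma computable_fst : computable1 pair_fst.
Proof. by rewrite /computable1 /pair_fst; computability. Qed.
#[local] Hint Resolve computable_fst : computability.

Lemma computable_snd : computable1 pair_snd.
Proof. by rewrite /computable1 /pair_snd; computability. Qed.
#[local] Hint Resolve computable_snd : computability.

(** * Operations on coded lists *)

Definition ccons x l := (cantor_pair x l).+1.
(** On 0, the code of the empty list, [chead] and [ctail] both give 0 because the pair (0, 0) has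
    code 0; this matches the default of [nth] and the tail of an empty list. *)
Definition chead l := pair_fst l.-1.
Definition ctail l := pair_snd l.-1.
Definition cdrop i l := iter i ctail l.
Definition cnth l i := chead (cdrop i l).
(** The code bounds the length of the list, so it also bounds the positions; the test against 0
    rules out the default value read past the end. *)
Definition cmem x l :=
  has (fun i => ~~ (cdrop i l == 0) && (chead (cdrop i l) == x)) (iota 0 l).

Lemma computable_ccons : computable2 ccons.
Proof. by rewrite /computable2 /ccons; computability. Qed.
Lemma computable_chead : computable1 chead.
Proof. by rewrite /computable1 /chead; computability. Qed.
Lemma computable_ctail : computable1 ctail.
Proof. by rewrite /computable1 /ctail; computability. Qed.
#[local] Hint Resolve computable_ccons computable_chead computable_ctail : computability.
Lemma computable_cdrop : computable2 cdrop.
Proof. by rewrite /computable2 /cdrop; computability. Qed.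
#[local] Hint Resolve computable_cdrop : computability.
Lemma computable_cnth : computable2 cnth.
Proof. by rewrite /computable2 /cnth; computability. Qed.
Lemma computable_cmem : computable2 cmem.
Proof. by rewrite /computable2 /cmem; computability. Qed.
#[local] Hint Resolve computable_cnth computable_cmem : computability.

Lemma chead_cons x l : chead (ccons x l) = x.
Proof. exact: pair_fstK. Qed.

Lemma ctail_cons x l : ctail (ccons x l) = l.
Proof. exact: pair_sndK. Qed.

Lemma code_list_cons x l : code_list (x :: l) = ccons x (code_list l).
Proof. by []. Qed.

Lemma chead_code l : chead (code_list l) = nth 0 l 0.
Proof.
by case: l => [|x l]; [exact: (pair_fstK 0 0) | rewrite code_list_cons chead_cons].
Qed.

Lemma ctail_code l : ctail (code_list l) = code_list (behead l).
Proof.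
by case: l => [|x l]; [exact: (pair_sndK 0 0) | rewrite code_list_cons ctail_cons].
Qed.

Lemma cdrop_code i l : cdrop i (code_list l) = code_list (drop i l).
Proof.
rewrite /cdrop; elim: i => [|i IH]; first by rewrite drop0.
by rewrite iterS IH ctail_code -drop1 drop_drop add1n.
Qed.

Lemma cnth_code l i : cnth (code_list l) i = nth 0 l i.
Proof. by rewrite /cnth cdrop_code chead_code nth_drop addn0. Qed.

Lemma code_list_eq0 l : (code_list l == 0) = nilp l.
Proof. by case: l. Qed.

Lemma size_code_list l : size l <= code_list l.
Proof.
by elim: l => //= x l IH; rewrite ltnS (leq_trans IH) // (leq_cantor_pair _ _).2.
Qed.

Lemma mem_code_list x l : x \in l -> x < code_list l.
Proof.
elim: l => //= y l IH; have [le_y le_l] := leq_cantor_pair y (code_list l).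
by rewrite inE ltnS => /orP[/eqP->//|/IH/ltnW/leq_trans->].
Qed.

Lemma cmem_code x l : cmem x (code_list l) = (x \in l).
Proof.
apply/hasP/(nthP 0) => [[i _]|[i lt_i <-]].
  rewrite cdrop_code code_list_eq0 chead_code nth_drop addn0 => /andP[ne0 /eqP<-].
  by exists i => //; move: ne0; rewrite /nilp size_drop subn_eq0 -ltnNge.
exists i; first by rewrite mem_iota (leq_trans lt_i) ?size_code_list.
rewrite cdrop_code code_list_eq0 chead_code nth_drop addn0 eqxx andbT.
by rewrite /nilp size_drop subn_eq0 -ltnNge.
Qed.

Lemma code_list_inj : injective code_list.
Proof.
by elim=> [|x l IH] [|y l'] //= [/cantor_pair_inj[-> /IH->]].
Qed.

Lemma code_list_surj n : exists l, n = code_list l.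
Proof.
have [k] := ubnP n; elim: k n => // k IH [|n]; first by exists [::].
have [x [m ->]] := cantor_pair_surj n; rewrite ltnS => lt_k.
have [|l ->] := IH m; last by exists (x :: l).
by apply: leq_ltn_trans lt_k; case: (leq_cantor_pair x m).
Qed.

(** * Coded derivations and the halting problem *)

(* The induction principle generated by Rocq misses the hypothesis hidden under
   the existential of [ev_min]. *)
Section EvalInduction.
Variables (P : rf -> seq nat -> nat -> Prop) (Q : seq rf -> seq nat -> seq nat -> Prop).
Hypothesis P_zero : forall xs, P rf_zero xs 0.
Hypothesis P_succ : forall xs, P rf_succ xs (nth 0 xs 0).+1.
Hypothesis P_proj : forall i xs, P (rf_proj i) xs (nth 0 xs i).
Hypothesis P_comp : forall f gs xs ys y, Q gs xs ys -> P f ys y -> P (rf_comp f gs) xs y.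
Hypothesis P_prec0 : forall f g xs y, P f xs y -> P (rf_prec f g) (0 :: xs) y.
Hypothesis P_precS : forall f g n xs z y, P (rf_prec f g) (n :: xs) z ->
  P g [:: n, z & xs] y -> P (rf_prec f g) (n.+1 :: xs) y.
Hypothesis P_min : forall f xs n, P f (n :: xs) 0 ->
  (forall m, m < n -> exists k, P f (m :: xs) k.+1) -> P (rf_min f) xs n.
Hypothesis Q_nil : forall xs, Q [::] xs [::].
Hypothesis Q_cons : forall g gs xs y ys, P g xs y -> Q gs xs ys ->
  Q (g :: gs) xs (y :: ys).

Fixpoint rf_eval_nested_ind e xs y (h : rf_eval e xs y) : P e xs y :=
  match h in rf_eval e xs y return P e xs y with
  | ev_zero xs => P_zero xs
  | ev_succ xs => P_succ xs
  | ev_proj i xs => P_proj i xs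
  | ev_comp f gs xs ys y hgs hf =>
      P_comp (rf_evals_nested_ind hgs) (rf_eval_nested_ind hf)
  | ev_prec0 f g xs y hf => P_prec0 g (rf_eval_nested_ind hf)
  | ev_precS f g n xs z y hn hg =>
      P_precS (rf_eval_nested_ind hn) (rf_eval_nested_ind hg)
  | ev_min f xs n h0 hlt => P_min (rf_eval_nested_ind h0)
      (fun m lt_mn => let: ex_intro k hk := hlt m lt_mn in
        ex_intro _ k (rf_eval_nested_ind hk))
  end
with rf_evals_nested_ind gs xs ys (h : rf_evals gs xs ys) : Q gs xs ys :=
  match h in rf_evals gs xs ys return Q gs xs ys with
  | evs_nil xs => Q_nil xs
  | evs_cons g gs xs y ys hg hgs =>
      Q_cons (rf_eval_nested_ind hg) (rf_evals_nested_ind hgs)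
  end.

End EvalInduction.

Fixpoint code_rf (e : rf) : nat :=
  match e with
  | rf_zero => cantor_pair 0 0
  | rf_succ => cantor_pair 1 0
  | rf_proj i => cantor_pair 2 i
  | rf_comp f gs => cantor_pair 3 (cantor_pair (code_rf f) (code_list (map code_rf gs)))
  | rf_prec f g => cantor_pair 4 (cantor_pair (code_rf f) (code_rf g))
  | rf_min f => cantor_pair 5 (code_rf f)
  end.

(** The extra tag 6 lets judgements of [rf_eval] and of [rf_evals] share one format. *)
Definition code_rfs (gs : seq rf) : nat := cantor_pair 6 (code_list (map code_rf gs)).

(* A derivation is the code of a list of judgements, each of which follows from
   the ones behind it in the list by a rule of [rf_eval] or [rf_evals]. *)
Definition judge c x y := cantor_pair c (cantor_pair x y).
Definition derived D c x y := cmem (judge c x y) D.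

(** The intermediate value [z] occurs in a judgement of [D], hence lies below the code [D], which
    bounds the search. The same bound serves the other rules. *)
Definition comp_rule D c x y :=
  has (fun z => derived D (cantor_pair 6 (pair_snd (pair_snd c))) x z &&
                derived D (pair_fst (pair_snd c)) z y) (iota 0 D).

(** The test on [x] is needed because [rf_prec] has no value on the empty list, where [chead] would
    read 0. *)
Definition prec_rule D c x y :=
  ~~ (x == 0) &&
  if chead x == 0 then derived D (pair_fst (pair_snd c)) (ctail x) y else
  has (fun z => derived D c (ccons (chead x).-1 (ctail x)) z &&
                derived D (pair_snd (pair_snd c))
                  (ccons (chead x).-1 (ccons z (ctail x))) y) (iota 0 D).

Definition min_rule D c x y :=
  derived D (pair_snd c) (ccons y x) 0 &&
  all (fun m => has (fun k => derived D (pair_snd c) (ccons m x) k.+1) (iota 0 D))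
      (iota 0 y).

Definition list_rule D c x y :=
  if pair_snd c == 0 then y == 0 else
  ~~ (y == 0) && (derived D (chead (pair_snd c)) x (chead y) &&
  derived D (cantor_pair 6 (ctail (pair_snd c))) x (ctail y)).

(** The tags are those of [code_rf] and [code_rfs]. Soundness and completeness are claimed only for
    codes of programs and of lists of programs. *)
Definition rule_applies D c x y : bool :=
  if pair_fst c == 0 then y == 0 else
  if pair_fst c == 1 then y == (chead x).+1 else
  if pair_fst c == 2 then y == cnth x (pair_snd c) else
  if pair_fst c == 3 then comp_rule D c x y else
  if pair_fst c == 4 then prec_rule D c x y else
  if pair_fst c == 5 then min_rule D c x y else list_rule D c x y.

Definition justified D J : bool :=
  rule_applies D (pair_fst J) (pair_fst (pair_snd J)) (pair_snd (pair_snd J)).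

Definition derivation D : bool :=
  all (fun i => if cdrop i D == 0 then true
                else justified (cdrop i.+1 D) (chead (cdrop i D))) (iota 0 D).

Lemma computable_derived : computable4 derived.
Proof. by rewrite /computable4 /derived /judge; computability. Qed.
#[local] Hint Resolve computable_derived : computability.
Lemma computable_comp_rule : computable4 comp_rule.
Proof. by rewrite /computable4 /comp_rule; computability. Qed.
Lemma computable_prec_rule : computable4 prec_rule.
Proof. by rewrite /computable4 /prec_rule; computability. Qed.
Lemma computable_min_rule : computable4 min_rule.
Proof. by rewrite /computable4 /min_rule; computability. Qed.
Lemma computable_list_rule : computable4 list_rule.
Proof. by rewrite /computable4 /list_rule; computability. Qed.
#[local] Hint Resolve computable_comp_rule computable_prec_rule computable_min_rule
  computable_list_rule : computability.
Lemma computable_rule_applies : computable4 rule_applies.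
Proof. by rewrite /computable4 /rule_applies; computability. Qed.
#[local] Hint Resolve computable_rule_applies : computability.
Lemma computable_justified : computable2 justified.
Proof. by rewrite /computable2 /justified; computability. Qed.
#[local] Hint Resolve computable_justified : computability.
Lemma computable_derivation : computable1 derivation.
Proof. by rewrite /computable1 /derivation; computability. Qed.
#[local] Hint Resolve computable_derivation : computability.

(** * Soundness and completeness of coded derivations *)

Fixpoint list_derivation (l : seq nat) : bool :=
  if l is J :: l' then justified (code_list l') J && list_derivation l' else true.

Lemma derivation_code l : derivation (code_list l) = list_derivation l.
Proof.
have -> : list_derivation l = all (fun i => if drop i l is J :: l' then
   justified (code_list l') J else true) (iota 0 (size l)).
  elim: l => //= J l ->; rewrite -[1]addn0 iotaDl all_map; congr (_ && _).
rewrite /derivation; apply/allP/allP => h i; rewrite mem_iota add0n => lt_i.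
  have := h i; rewrite mem_iota (leq_trans lt_i (size_code_list l)) => /(_ isT).
  rewrite !cdrop_code chead_code -add1n -drop_drop drop1.
  by case: (drop i l).
rewrite !cdrop_code chead_code -add1n -drop_drop drop1.
have [lt_il|le_li] := ltnP i (size l); last by rewrite drop_oversize.
by have := h i; rewrite mem_iota lt_il => /(_ isT); case: (drop i l).
Qed.

Lemma derived_code l c x y : derived (code_list l) c x y = (judge c x y \in l).
Proof. exact: cmem_code. Qed.

Lemma justified_judge D c x y : justified D (judge c x y) = rule_applies D c x y.
Proof. by rewrite /justified /judge !(pair_fstK, pair_sndK). Qed.

(** Inversion: the part of the list behind the judgement is itself a derivation and holds the
    premises. *)
Lemma judge_rule l c x y : list_derivation l -> judge c x y \in l ->
  exists2 l', list_derivation l' & rule_applies (code_list l') c x y.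
Proof.
elim: l => //= J l IH /andP[hJ hl]; rewrite inE => /orP[/eqP eJ|]; last exact: IH.
by exists l => //; rewrite -justified_judge eJ.
Qed.

(** Soundness takes the form of uniqueness: a derivation cannot contradict an actual evaluation,
    which is what the diagonal argument uses. The induction is on the evaluation, and the last rule
    of the derivation is inverted. *)
Lemma derivation_sound e xs y : rf_eval e xs y -> forall l y',
  list_derivation l -> judge (code_rf e) (code_list xs) y' \in l -> y' = y.
Proof.
pose Q gs xs ys := forall l z, list_derivation l ->
  judge (code_rfs gs) (code_list xs) z \in l -> z = code_list ys.
move: e xs y; apply: (@rf_eval_nested_ind _ Q).
- move=> xs l y' hl /(judge_rule hl)[l' _].
  by rewrite /rule_applies /code_rf pair_fstK => /eqP.
- move=> xs l y' hl /(judge_rule hl)[l' _].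
  by rewrite /rule_applies /code_rf pair_fstK chead_code => /eqP.
- move=> i xs l y' hl /(judge_rule hl)[l' _].
  by rewrite /rule_applies /= pair_fstK pair_sndK cnth_code => /eqP.
- move=> f gs xs ys y IHgs IHf l y' hl /(judge_rule hl)[l' hl'].
  rewrite /rule_applies /comp_rule /= !(pair_fstK, pair_sndK) /= => /hasP[z _].
  rewrite !derived_code => /andP[hz hy].
  by rewrite (IHgs _ _ hl' hz) in hy; apply: IHf hl' hy.
- move=> f g xs y IHf l y' hl /(judge_rule hl)[l' hl'].
  rewrite /rule_applies /prec_rule /= !(pair_fstK, pair_sndK) /=.
  rewrite -/(ccons _ _) chead_cons ctail_cons /= derived_code; exact: IHf.
- move=> f g n xs z y IHn IHg l y' hl /(judge_rule hl)[l' hl'].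
  rewrite /rule_applies /prec_rule /= !(pair_fstK, pair_sndK) /=.
  rewrite -/(ccons _ _) chead_cons ctail_cons /= => /hasP[z' _].
  rewrite !derived_code => /andP[hz hy].
  by rewrite (IHn _ _ hl' hz) in hy; apply: IHg hl' hy.
- move=> f xs n IH0 IHlt l y' hl /(judge_rule hl)[l' hl'].
  rewrite /rule_applies /min_rule /= !(pair_fstK, pair_sndK) /=.
  rewrite derived_code => /andP[h0 /allP hlt].
  (* If y' < n, the derivation claims the value 0 at y', where [f] has a successor value; if y' > n,
     it claims a successor value at n, where [f] is 0. *)
  case: (ltngtP y' n) => // [/IHlt[k IHk]|lt_n]; first by have := IHk _ _ hl' h0.
  have /hlt/hasP[k _] : n \in iota 0 y' by rewrite mem_iota.
  by rewrite derived_code => /(IH0 _ _ hl').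
- move=> xs l z hl /(judge_rule hl)[l' hl'].
  by rewrite /rule_applies /list_rule /code_rfs !(pair_fstK, pair_sndK) /= => /eqP.
- move=> g gs xs y ys IHg IHgs l z hl /(judge_rule hl)[l' hl'].
  rewrite /rule_applies /list_rule /code_rfs !(pair_fstK, pair_sndK) /=.
  rewrite -/(ccons _ _) chead_cons ctail_cons.
  have [[|z' zs] ->] := code_list_surj z => //.
  rewrite code_list_cons chead_cons ctail_cons !derived_code /= => /andP[hz hzs].
  by rewrite (IHg _ _ hl' hz) (IHgs _ _ hl' hzs).
Qed.

Lemma judge_lt l c x y : judge c x y \in l -> x < code_list l /\ y < code_list l.
Proof.
move=> /mem_code_list lt_J.
have [_ le_xy] := leq_cantor_pair c (cantor_pair x y).
by have [le_x le_y] := leq_cantor_pair x y; split;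
  apply: leq_ltn_trans lt_J; apply: leq_trans le_xy.
Qed.

(** Premises persist, and the bounded searches still succeed since each witness occurs in a
    judgement of [l'] and so lies below its code. *)
Lemma rule_applies_mono l l' c x y : {subset l <= l'} ->
  rule_applies (code_list l) c x y -> rule_applies (code_list l') c x y.
Proof.
move=> sub; have sub_d a b d : derived (code_list l) a b d -> derived (code_list l') a b d.
  by rewrite !derived_code; apply: sub.
rewrite /rule_applies /comp_rule /prec_rule /min_rule /list_rule.
do 3![case: ifP => [//|_]]; case: ifP => _.
  move=> /hasP[z _ /andP[/sub_d hz /sub_d hy]]; apply/hasP; exists z; rewrite ?hz //.
  by move: hz; rewrite mem_iota derived_code => /judge_lt[].
case: ifP => _.
  move=> /andP[-> /=]; case: ifP => _; first exact: sub_d.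
  move=> /hasP[z _ /andP[/sub_d hz /sub_d hy]]; apply/hasP; exists z; rewrite ?hz //.
  by move: hz; rewrite mem_iota derived_code => /judge_lt[].
case: ifP => _.
  move=> /andP[/sub_d-> /allP h]; apply/allP => m /h /hasP[k _ /sub_d hk].
  apply/hasP; exists k => //; move: hk; rewrite mem_iota derived_code => /judge_lt[_].
  exact: ltnW.
by case: ifP => // _ /and3P[-> /sub_d-> /sub_d->].
Qed.

Lemma list_derivation_cat l l' :
  list_derivation l -> list_derivation l' -> list_derivation (l ++ l').
Proof.
elim: l => //= J l IH /andP[hJ hl] hl'; rewrite IH // andbT.
by apply: rule_applies_mono hJ => x; rewrite mem_cat => ->.
Qed.

Definition derivable c x y := exists2 l, list_derivation l & judge c x y \in l.

Lemma derivable_by_rule l c x y : list_derivation l ->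
  rule_applies (code_list l) c x y -> derivable c x y.
Proof.
move=> hl hr; exists (judge c x y :: l); last by rewrite mem_head.
by rewrite /= justified_judge hr.
Qed.

Lemma derivable_both c x y c' x' y' : derivable c x y -> derivable c' x' y' ->
  exists l, [/\ list_derivation l, judge c x y \in l & judge c' x' y' \in l].
Proof.
move=> [l hl Jl] [l' hl' Jl']; exists (l ++ l').
by rewrite !mem_cat Jl Jl' orbT list_derivation_cat.
Qed.

(** By induction on the evaluation, derivations of the premises are concatenated and the conclusion
    is put in front. *)
Lemma derivation_complete e xs y :
  rf_eval e xs y -> derivable (code_rf e) (code_list xs) y.
Proof.
pose Q gs xs ys := derivable (code_rfs gs) (code_list xs) (code_list ys).
have has_z l c x z (P : pred nat) : judge c x z \in l -> P z ->
    has P (iota 0 (code_list l)).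
  by move=> /judge_lt[_ lt_z] Pz; apply/hasP; exists z; rewrite ?mem_iota.
move: e xs y; apply: (@rf_eval_nested_ind _ Q).
- move=> xs; apply: (@derivable_by_rule [::] _ _ _ isT).
  by rewrite /rule_applies /code_rf pair_fstK.
- move=> xs; apply: (@derivable_by_rule [::] _ _ _ isT).
  by rewrite /rule_applies /code_rf pair_fstK chead_code /= eqxx.
- move=> i xs; apply: (@derivable_by_rule [::] _ _ _ isT).
  by rewrite /rule_applies /= pair_fstK pair_sndK cnth_code /= eqxx.
- move=> f gs xs ys y hgs hf; have [l [hl Jgs Jf]] := derivable_both hgs hf.
  apply: (derivable_by_rule hl).
  rewrite /rule_applies /comp_rule /= !(pair_fstK, pair_sndK) /=.
  by apply: (has_z _ _ _ _ _ Jgs); rewrite !derived_code Jgs Jf.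
- move=> f g xs y [l hl Jf]; apply: (derivable_by_rule hl).
  rewrite /rule_applies /prec_rule /= !(pair_fstK, pair_sndK) /=.
  by rewrite -/(ccons _ _) chead_cons ctail_cons /= derived_code.
- move=> f g n xs z y hn hg; have [l [hl Jn Jg]] := derivable_both hn hg.
  apply: (derivable_by_rule hl).
  rewrite /rule_applies /prec_rule /= !(pair_fstK, pair_sndK) /=.
  rewrite -/(ccons _ _) chead_cons ctail_cons /=.
  by apply: (has_z _ _ _ _ _ Jn); rewrite !derived_code Jn Jg.
- move=> f xs n h0 hlt.
  (* The derivations for all arguments below n are merged into one list by induction on n. *)
  have [l hl Jlt] : exists2 l, list_derivation l & forall m, m < n ->
      exists k, judge (code_rf f) (code_list (m :: xs)) k.+1 \in l.
    elim: n {h0} hlt => [|n IH] hlt; first by exists [::].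
    have [l hl Jl] := IH (fun m lt => hlt m (ltnW lt)).
    have [k [l' hl' Jk]] := hlt n (ltnSn n).
    exists (l ++ l') => [|m]; first exact: list_derivation_cat.
    rewrite ltnS leq_eqVlt => /orP[/eqP->|/Jl[k' Jk']].
      by exists k; rewrite mem_cat Jk orbT.
    by exists k'; rewrite mem_cat Jk'.
  have [l' hl' J0] := h0.
  apply: (derivable_by_rule (list_derivation_cat hl hl')).
  rewrite /rule_applies /min_rule /= !(pair_fstK, pair_sndK) /=.
  rewrite derived_code mem_cat J0 orbT /=; apply/allP => m; rewrite mem_iota.
  move=> /Jlt[k Jk]; have {}Jk : judge (code_rf f) (code_list (m :: xs)) k.+1 \in l ++ l'.
    by rewrite mem_cat Jk.
  apply/hasP; exists k; last by rewrite derived_code.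
  by have [_ /ltnW] := judge_lt Jk; rewrite mem_iota.
- move=> xs; apply: (@derivable_by_rule [::] _ _ _ isT).
  by rewrite /rule_applies /list_rule /code_rfs !(pair_fstK, pair_sndK).
- move=> g gs xs y ys hg hgs; have [l [hl Jg Jgs]] := derivable_both hg hgs.
  apply: (derivable_by_rule hl).
  rewrite /rule_applies /list_rule /code_rfs !(pair_fstK, pair_sndK) /=.
  by rewrite -!/(ccons _ _) !chead_cons !ctail_cons !derived_code Jg.
Qed.

(* [halts_at c s]: s is the least code of a derivation of "machine c returns 0
   on input c". *)
Definition halts_by c s := derivation s && derived s c (ccons c 0) 0.
Definition halts_at c s := halts_by c s && all (fun r => ~~ halts_by c r) (iota 0 s).

Lemma computable_halts_by : computable2 halts_by.
Proof. by rewrite /computable2 /halts_by; computability. Qed.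
#[local] Hint Resolve computable_halts_by : computability.
Lemma computable_halts_at : computable2 halts_at.
Proof. by rewrite /computable2 /halts_at; computability. Qed.
#[local] Hint Resolve computable_halts_at : computability.

Lemma halts_at_unique c s s' : halts_at c s -> halts_at c s' -> s = s'.
Proof.
move=> /andP[hs /allP ls] /andP[hs' /allP ls']; case: (ltngtP s s') => // lt.
  by have := ls' s; rewrite hs mem_iota lt => /(_ isT).
by have := ls s'; rewrite hs' mem_iota lt => /(_ isT).
Qed.

(** Diagonal argument: run [e] on its own code. If this halts with 0, then [e] answers 1, against
    uniqueness; so it does not halt with 0, and then [e] answers 0. The answer 0 for non-halting is
    what a word problem decider gives on a trivial word. *)
Lemma halting_undecidable e :
  ~ (forall c, ((exists s, halts_at c s) -> rf_eval e [:: c] 1) /\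
               (~ (exists s, halts_at c s) -> rf_eval e [:: c] 0)).
Proof.
move=> /(_ (code_rf e)); set c := code_rf e => -[hyes hno].
have nhalt : ~ exists s, halts_at c s.
  move=> h; have {}hyes := hyes h; case: h => s /andP[/andP[]].
  have [l ->] := code_list_surj s; rewrite derivation_code derived_code => hl J _.
  by have := derivation_sound hyes hl J.
have [l hl J] := derivation_complete (hno nhalt).
have ex : exists s, halts_by c s.
  by exists (code_list l); rewrite /halts_by derivation_code hl derived_code.
apply: nhalt; exists (ex_minn ex); case: ex_minnP => s hs min_s.
rewrite /halts_at hs; apply/allP => r; rewrite mem_iota /= => lt_r.
by apply/negP => /min_s; rewrite leqNgt lt_r.
Qed.

(** * The exponents *)

(** This is the exponent of machine [j] as known from the stages below [N]; at most one summand is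
    nonzero. For [N] with [stable j N] it is the final exponent. *)
Definition expo j N := j.+1`! + \sum_(0 <= s < N) halts_at j s * (j + s).+2`!.
Definition stable j N := forall s, N <= s -> ~~ halts_at j s.

Lemma computable_expo : computable2 expo.
Proof. by rewrite /computable2 /expo; computability. Qed.
#[local] Hint Resolve computable_expo : computability.

Lemma stable_exists j : exists N, stable j N.
Proof.
case: (classic (exists s, halts_at j s)) => [[s hs]|no]; last first.
  by exists 0 => s _; apply/negP => hs; apply: no; exists s.
exists s.+1 => r lt_sr; apply/negP => hr.
by rewrite (halts_at_unique hs hr) ltnn in lt_sr.
Qed.

Lemma dvdn_fact2 m n : m <= n -> m`! %| n`!.
Proof.
elim: n => [|n IH]; first by rewrite leqn0 => /eqP->.
by rewrite leq_eqVlt => /orP[/eqP->//|/IH h]; rewrite factS dvdn_mull.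
Qed.

Lemma expo_stable j M N : stable j M -> M <= N -> expo j N = expo j M.
Proof.
move=> stM le_MN; rewrite /expo (big_cat_nat (leq0n M) le_MN) /= [X in _ + (_ + X)]big1_seq ?addn0 //.
by move=> s /andP[_]; rewrite mem_index_iota => /andP[/stM/negbTE->].
Qed.

(** A stage s >= n contributes a multiple of (j+s+2)!, hence of n!. *)
Lemma expo_trunc j n N : n <= N -> expo j N = expo j n %[mod n`!].
Proof.
move=> le_nN; rewrite /expo (big_cat_nat (leq0n n) le_nN) /= addnA.
apply/eqP; rewrite -[eqbRHS]modnDr -modnDmr; apply/eqP.
have -> : (\sum_(n <= s < N) halts_at j s * (j + s).+2`!) %% n`! = 0.
  apply/eqP; rewrite -/(dvdn _ _) big_nat; apply: dvdn_sum => s /andP[le_ns _].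
  by rewrite dvdn_mull // dvdn_fact2 //; lia.
by rewrite addn0 modnDr.
Qed.

Lemma expo_dvd j n N : n <= j.+1 -> n`! %| expo j N.
Proof.
move=> le_nj; rewrite dvdn_add ?dvdn_fact2 //; apply: dvdn_sum => s _.
by rewrite dvdn_mull // dvdn_fact2 //; lia.
Qed.

(** Modulo (j+2)! the exponent is (j+1)!, hence nonzero; this tells the exponents of different
    machines apart. *)
Lemma expo_next j N : exists d, expo j N = j.+1`! + d * j.+2`!.
Proof.
suff /dvdnP[d hd] : j.+2`! %| \sum_(0 <= s < N) halts_at j s * (j + s).+2`!.
  by exists d; rewrite /expo hd.
by apply: dvdn_sum => s _; rewrite dvdn_mull // dvdn_fact2 //; lia.
Qed.

Lemma expo_halting j s N : halts_at j s -> stable j N ->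
  expo j N = j.+1`! + (j + s).+2`!.
Proof.
move=> hs stN; have lt_sN : s < N.
  by rewrite ltnNge; apply/negP => /stN; rewrite hs.
rewrite /expo big_mkord (bigD1 (Ordinal lt_sN)) //= hs mul1n big1 ?addn0 // => r ne_r.
case hr: (halts_at j r) => //.
by case/eqP: ne_r; apply: val_inj; rewrite /= (halts_at_unique hs hr).
Qed.

(** * Tame pairs of permutations *)

(** Quantifying over stable [N] expresses the relation for the final exponent, as all stable [N]
    give the same value. *)
Definition tame n (x y : 'S_n) :=
  forall j N, stable j N -> commute x (x ^ (y ^+ expo j N))%g.

Lemma expg_fact_eq n (y : 'S_n) i k : i = k %[mod n`!] -> (y ^+ i = y ^+ k)%g.
Proof.
have y1 : (y ^+ n`! = 1)%g.
  by rewrite -card_Sn -cardsT expg_cardG ?inE.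
by move=> eq_ik; rewrite -(expg_mod i y1) eq_ik expg_mod.
Qed.

(** Exponents of [y] count modulo n!. This cuts off the stages from n on, and makes the relations of
    the machines j >= n trivial, so finitely many decidable conditions remain. *)
Lemma tame_bounded n (x y : 'S_n) :
  tame x y <-> forall j, j < n -> commute x (x ^ (y ^+ expo j n))%g.
Proof.
have trunc j N : stable j N -> expo j N = expo j n %[mod n`!].
  (* Either n <= N and truncation applies, or N < n and the exponent no longer changes after [N]. *)
  move=> stN; have [/expo_trunc->//|/ltnW/(expo_stable stN)->//] := leqP n N.
split=> [h j _|h j N stN].
  by have [N stN] := stable_exists j; rewrite -(expg_fact_eq y (trunc _ _ stN)); apply: h.
have [lt_jn|le_nj] := ltnP j n; first by rewrite (expg_fact_eq y (trunc _ _ stN)); apply: h.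
rewrite (@expg_fact_eq n y _ 0) ?expg0 ?conjg1 //.
by apply/eqP; rewrite mod0n -/(dvdn _ _) expo_dvd // leqW.
Qed.

Lemma ordS_iter m k (z : 'I_m) : iter k (@ordS m) z = (z + k) %% m :> nat.
Proof.
elim: k => [|k IH] /=; first by rewrite addn0 modn_small.
by rewrite IH -addn1 modnDml addn1 addnS.
Qed.

(* For q = (c+1)! and m = (c+s+5)!, the transposition (0 q) is moved by the
   k-th power of the m-cycle to a transposition commuting with it unless
   k = q or k = -q modulo m. *)
Lemma tame_separation c s : halts_at c s ->
  exists m (x y : 'S_m), tame x y /\ ~ commute x (x ^ (y ^+ c.+1`!))%g.
Proof.
move=> hs; set q := c.+1`!; set m := (c + s).+4.+1`!.
have q_gt0 : 0 < q by apply: fact_gt0.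
set L := (c + s).+2`!.
have L_gt0 : 0 < L by apply: fact_gt0.
have le_qL : q <= L by apply: leq_fact; lia.
(* With q <= L this leaves room below m for 2q and for 2q + L, so that sums below need no reduction
   modulo m. *)
have lt_Lm : 3 * L < m by rewrite /m 3!factS -/L; nia.
have lt0m : 0 < m by lia.
have ltqm : q < m by lia.
pose o0 : 'I_m := Ordinal lt0m; pose oq : 'I_m := Ordinal ltqm.
pose x : 'S_m := tperm o0 oq; pose y : 'S_m := perm (can_inj (@ordSK m)).
have yX k (z : 'I_m) : (y ^+ k)%g z = (z + k) %% m :> nat.
  rewrite -ordS_iter permX; congr (nat_of_ord _).
  by elim: k => //= k ->; rewrite permE.
exists m, x, y; split; last first.
  (* The transpositions (0 q) and (q 2q) share the point q: their two products send 0 to 2q and to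
     q. *)
  rewrite /x tpermJ => /permP/(_ o0); rewrite !permM tpermL.
  set u := (y ^+ q)%g o0; set v := (y ^+ q)%g oq.
  have eu : u = oq by apply: val_inj; rewrite /= yX add0n modn_small.
  have ev : v = q + q :> nat by rewrite yX modn_small //=; lia.
  rewrite -eu tpermL eu tpermD ?tpermL.
  - by move/(congr1 (@nat_of_ord _)); rewrite ev /=; lia.
  - by rewrite eq_sym -val_eqE /=; lia.
  - by rewrite -val_eqE /= ev; lia.
move=> j N stN; set k := expo j N.
suff [ne_q ne_Nq] : ~~ (k == q %[mod m]) /\ ~~ (m %| k + q).
  rewrite /x tpermJ.
  (* If m divides k the conjugation is trivial; otherwise k and q + k differ modulo m from 0 and q,
     and the two transpositions are disjoint. *)
  have [dvd_k|ndvd_k] := boolP (m %| k).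
    have -> : (y ^+ k = 1)%g; last by rewrite !perm1; exact: commute_refl.
    apply/permP => z; apply: val_inj; rewrite /= yX perm1 -modnDmr (eqP dvd_k) addn0.
    exact: modn_small.
  set u := (y ^+ k)%g o0; set v := (y ^+ k)%g oq.
  have eu : u = k %% m :> nat by rewrite yX.
  have ev : v = (q + k) %% m :> nat by rewrite yX.
  have ne_u0 : u != o0 by rewrite -val_eqE /= eu.
  have ne_uq : u != oq by rewrite -val_eqE /= eu -[q in _ != q](modn_small ltqm).
  have ne_v0 : v != o0 by rewrite -val_eqE /= ev addnC.
  have ne_vq : v != oq.
    rewrite -val_eqE /= ev -[q in _ != q](modn_small ltqm) -[q in _ != q %% m]addn0.
    by rewrite eqn_modDl mod0n.
  apply/commgP/conjg_fixP; rewrite tpermJ !tpermD //.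
(* For j < c, (j+2)! divides m and q but not k. For j > c, (c+2)! divides m and k but not q. For j =
   c, halting gives k = q + L, and sizes decide. *)
case: (ltngtP j c) => [lt_jc|lt_cj|eq_jc].
- have dvd_m : j.+2`! %| m by apply: dvdn_fact2; lia.
  have dvd_q : j.+2`! %| q by apply: dvdn_fact2; lia.
  have nd : ~~ (j.+2`! %| k).
    have [d hd] := expo_next j N; rewrite /k hd (dvdn_addl _ (dvdn_mull _ (dvdnn _))).
    by rewrite gtnNdvd ?fact_gt0 // [j.+2`!]factS ltn_Pmull ?fact_gt0.
  split; apply/negP.
    move=> /eqP eq_k; case/negP: nd.
    by rewrite /dvdn -(modn_dvdm k dvd_m) eq_k modn_dvdm.
  by move/(dvdn_trans dvd_m); rewrite dvdn_addl // (negbTE nd).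
- have dvd_m : c.+2`! %| m by apply: dvdn_fact2; lia.
  have dvd_k : c.+2`! %| k by apply: expo_dvd; lia.
  have nd : ~~ (c.+2`! %| q).
    by rewrite gtnNdvd // [c.+2`!]factS ltn_Pmull.
  split; apply/negP.
    move=> /eqP eq_k; case/negP: nd.
    by rewrite /dvdn -(modn_dvdm q dvd_m) -eq_k modn_dvdm.
  by move/(dvdn_trans dvd_m); rewrite dvdn_addr // (negbTE nd).
- subst j; have -> : k = q + L by rewrite /k (expo_halting hs stN).
  split; last by rewrite gtnNdvd //; lia.
  by rewrite !modn_small; lia.
Qed.

(** * Abstract groups and their words *)

Section AbsGroupTheory.
Variable G : abs_group.
Implicit Types x y : G.

Lemma gmulKl x y : gmul (ginv x) (gmul x y) = y.
Proof. by rewrite gmulA gmulV gmul1. Qed.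

Lemma gmulI x y z : gmul x y = gmul x z -> y = z.
Proof. by move=> /(congr1 (gmul (ginv x))); rewrite !gmulKl. Qed.

Lemma gmulr1 x : gmul x (gone G) = x.
Proof. by apply: (@gmulI (ginv x)); rewrite gmulA gmulV gmul1. Qed.

Lemma gmulVr x : gmul x (ginv x) = gone G.
Proof. by apply: (@gmulI (ginv x)); rewrite gmulA gmulV gmul1 gmulr1. Qed.

Lemma ginvK x : ginv (ginv x) = x.
Proof. by apply: (@gmulI (ginv x)); rewrite gmulVr gmulV. Qed.

Lemma ginvM x y : ginv (gmul x y) = gmul (ginv y) (ginv x).
Proof.
apply: (@gmulI (gmul x y)); rewrite gmulVr gmulA -(gmulA x) gmulVr gmulr1.
by rewrite gmulVr.
Qed.

Lemma ginv1 : ginv (gone G) = gone G.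
Proof. by apply: (@gmulI (gone G)); rewrite gmulVr gmul1. Qed.

Lemma word_val_cat (s : nat -> G) w w' :
  word_val s (w ++ w') = gmul (word_val s w) (word_val s w').
Proof. by elim: w => [|l w IH] /=; rewrite ?gmul1 // IH gmulA. Qed.

Definition flip_letter l := if odd l then l.-1 else l.+1.

Lemma letter_val_flip (s : nat -> G) l :
  letter_val s (flip_letter l) = ginv (letter_val s l).
Proof.
rewrite /letter_val /flip_letter; case ol: (odd l) => /=; last first.
  by rewrite ol uphalf_half ol.
by case: l ol => //= l ol; rewrite (negbTE ol) ginvK uphalf_half (negbTE ol).
Qed.

Lemma word_val_inv (s : nat -> G) w :
  word_val s (rev (map flip_letter w)) = ginv (word_val s w).
Proof.
elim: w => [|l w IH] /=; first by rewrite ginv1.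
by rewrite rev_cons -cats1 word_val_cat IH ginvM /= gmulr1 letter_val_flip.
Qed.

Lemma valid_word_inv d w : valid_word d w -> valid_word d (rev (map flip_letter w)).
Proof.
rewrite /valid_word all_rev all_map; apply: sub_all => l /=.
by rewrite /flip_letter; case ol: (odd l); lia.
Qed.

End AbsGroupTheory.

Section Generated.
Variables (B : abs_group) (d : nat) (s : nat -> B).

Definition in_generated (x : B) := exists w, valid_word d w /\ word_val s w = x.

Lemma in_generatedM x y : in_generated x -> in_generated y -> in_generated (gmul x y).
Proof.
move=> [w [vw <-]] [w' [vw' <-]]; exists (w ++ w'); rewrite word_val_cat; split=> //.
by rewrite /valid_word all_cat vw.
Qed.

Lemma in_generated1 : in_generated (gone B).
Proof. by exists [::]. Qed.

Lemma in_generatedV x : in_generated x -> in_generated (ginv x).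
Proof.
move=> [w [vw <-]]; exists (rev (map flip_letter w)); rewrite word_val_inv.
by split=> //; apply: valid_word_inv.
Qed.

Definition generated_car := {x : B | in_generated x}.

Lemma generated_eq (x y : generated_car) : sval x = sval y -> x = y.
Proof. by case: x y => [x hx] [y hy] /= exy; subst y; rewrite (proof_irrelevance _ hx hy). Qed.

(** The proof ends with [Defined] so that the operations reduce to those of [B] under [sval]. *)
Definition generated : abs_group.
Proof.
refine (@AbsGroup generated_car
  (fun x y => exist _ _ (in_generatedM (svalP x) (svalP y)))
  (exist _ _ in_generated1)
  (fun x => exist _ _ (in_generatedV (svalP x))) _ _ _).
- by move=> x y z; apply: generated_eq; rewrite /= gmulA.
- by move=> x; apply: generated_eq; rewrite /= gmul1.
- by move=> x; apply: generated_eq; rewrite /= gmulV.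
Defined.

Hypothesis gens_in : forall k, in_generated (s k).
Definition generated_gens (k : nat) : generated := exist _ _ (gens_in k).

Lemma generated_word w : sval (word_val generated_gens w) = word_val s w.
Proof.
by elim: w => //= l w <-; congr gmul; rewrite /letter_val; case: odd.
Qed.

Lemma generated_generates : generates d generated_gens.
Proof.
move=> [x [w [vw ew]]]; exists w; split=> //.
by apply: generated_eq; rewrite generated_word.
Qed.

End Generated.

Definition product_group (I : Type) (gT : I -> finGroupType) : abs_group.
Proof.
refine (@AbsGroup (forall i, gT i) (fun x y i => (x i * y i)%g) (fun=> 1%g)
  (fun x i => (x i)^-1%g) _ _ _).
- by move=> x y z; apply: functional_extensionality_dep => i; rewrite mulgA.
- by move=> x; apply: functional_extensionality_dep => i; rewrite mul1g.
- by move=> x; apply: functional_extensionality_dep => i; rewrite mulVg.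
Defined.

Lemma product_power (I : Type) (gT : I -> finGroupType) (s : nat -> product_group gT)
  k l w i :
  word_val s (nseq k l ++ w) i = (letter_val s l i ^+ k * word_val s w i)%g.
Proof. by elim: k => [|k IH] /=; rewrite ?mul1g // IH expgS mulgA. Qed.

(** * The group *)

(** These are the indices of the product: every tame pair of every degree occurs, so each one is a
    coordinate of the universal pair. *)
Record tame_pair := TamePair {
  degree : nat;
  first_perm : 'S_degree;
  second_perm : 'S_degree;
  tame_pairP : tame first_perm second_perm }.

Definition tame_product : abs_group :=
  product_group (fun i : tame_pair => {perm 'I_(degree i)} : finGroupType).

Definition universal_pair (k : nat) : tame_product :=
  fun i => if k == 0 then first_perm i else second_perm i.

(** The letters 0 and 2 stand for the two generators; every index from 1 on repeats the second
    one. *)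
Lemma universal_pair_in k : in_generated 2 universal_pair (universal_pair k).
Proof.
by case: k => [|k]; [exists [:: 0] | exists [:: 2]]; split=> //;
  apply: functional_extensionality_dep => i; rewrite /= mulg1.
Qed.

Definition tame_group := generated 2 universal_pair.
Definition tame_gens : nat -> tame_group := generated_gens universal_pair_in.

(** A nontrivial element differs from 1 in some coordinate, and the projection to that coordinate is
    a finite quotient. *)
Lemma tame_group_residually_finite : residually_finite tame_group.
Proof.
move=> g g_neq1.
have [i gi] : exists i, sval g i <> 1%g.
  apply: not_all_ex_not => h; apply: g_neq1; apply: generated_eq.
  exact: functional_extensionality_dep.
by exists {perm 'I_(degree i)}, (fun x => sval x i).
Qed.

(** With a = 0, a^-1 = 1, t = 2 and t^-1 = 3 as letters, this spells the commutator [a, a^(t^k)]. *)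
Definition comm_word k : seq nat :=
  1 :: nseq k 3 ++ 1 :: nseq k 2 ++ 0 :: nseq k 3 ++ 0 :: nseq k 2.

Lemma comm_word_valid k : valid_word 2 (comm_word k).
Proof.
by rewrite /valid_word /comm_word; do 4!rewrite /= ?all_cat ?all_nseq ?orbT.
Qed.

Lemma comm_wordP k : word_val tame_gens (comm_word k) = gone tame_group <->
  forall i : tame_pair, commute (first_perm i) (first_perm i ^ (second_perm i ^+ k))%g.
Proof.
have val i : word_val universal_pair (comm_word k) i =
    [~ first_perm i, first_perm i ^ (second_perm i ^+ k)]%g.
  have cons l w : word_val universal_pair (l :: w) i =
      (letter_val universal_pair l i * word_val universal_pair w i)%g by [].
  rewrite /comm_word -[nseq k 2 in X in 0 :: nseq k 3 ++ 0 :: X]cats0.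
  rewrite !(cons, product_power) /=.
  rewrite /letter_val /universal_pair /= commgEl !conjgE !invMg !invgK !mulg1.
  by rewrite expgVn !mulgA.
split=> [/(congr1 (@sval _ _)) h i|h].
  apply/commgP; rewrite -val; move: h; rewrite /tame_gens generated_word => ->.
  by rewrite /= eqxx.
apply: generated_eq; rewrite /tame_gens generated_word.
apply: functional_extensionality_dep => i; rewrite val /=.
by apply/eqP/commgP; apply: h.
Qed.

(** If c halts, the separating pair is a coordinate where the word is nontrivial. If not, stage 0 is
    already stable and the exponent of c is (c+1)!. *)
Lemma comm_word_fact c :
  word_val tame_gens (comm_word c.+1`!) = gone tame_group <-> ~ exists s, halts_at c s.
Proof.
rewrite comm_wordP; split=> [h [s /tame_separation[m [x [y [txy]]]]]|nhalt i].
  by apply; apply: (h (TamePair txy)).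
have st : stable c 0 by move=> s _; apply/negP => hs; apply: nhalt; exists s.
by have := @tame_pairP i _ _ st; rewrite /expo big_nil addn0.
Qed.

(** The code is built from the right by iterated [ccons], a form in which its computability is
    immediate. *)
Definition code_comm_word k :=
  ccons 1 (iter k (ccons 3) (ccons 1 (iter k (ccons 2)
    (ccons 0 (iter k (ccons 3) (ccons 0 (iter k (ccons 2) 0))))))).

Lemma code_comm_wordE k : code_list (comm_word k) = code_comm_word k.
Proof.
have cat_nseq l w : code_list (nseq k l ++ w) = iter k (ccons l) (code_list w).
  by elim: k => //= j ->.
by rewrite /comm_word -[nseq k 2 in X in 0 :: X]cats0 !(code_list_cons, cat_nseq).
Qed.

Lemma computable_code_comm_word : computable1 code_comm_word.
Proof. by rewrite /computable1 /code_comm_word; computability. Qed.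
#[local] Hint Resolve computable_code_comm_word : computability.

(** Composed with the computable map from c to the code of its commutator word, a decider would
    answer 1 exactly when c halts. *)
Lemma tame_group_WP : ~ WP_solvable 2 tame_gens.
Proof.
move=> [e he].
have [f hf] : computable1 (fun c => code_comm_word c.+1`!).
  by rewrite /computable1; computability.
apply: (@halting_undecidable (rf_comp e [:: f])) => c.
have [hyes hno] : (_ /\ _) := he (code_comm_word c.+1`!)
  (ex_intro _ _ (conj (comm_word_valid _) (esym (code_comm_wordE _)))).
have run y : rf_eval e [:: code_comm_word c.+1`!] y -> rf_eval (rf_comp e [:: f]) [:: c] y.
  move=> hy; apply: ev_comp hy; constructor; last by constructor.
  exact: (hf [:: c]).
split=> [hc|hc]; apply: run.
  apply: hno => -[w [vw [ew w1]]].
  have ec : comm_word c.+1`! = w by apply: code_list_inj; rewrite code_comm_wordE.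
  by rewrite -ec in w1; case/comm_word_fact: w1.
apply: hyes; exists (comm_word c.+1`!); rewrite code_comm_wordE.
by split; [exact: comm_word_valid | split=> //; apply/comm_word_fact].
Qed.

(** * Finite quotients *)

(** Right translations are used, because permutations compose from left to right. *)
Lemma cayley n T : group_table n T -> exists (rho : nat -> 'S_n) (e : 'I_n),
  [/\ forall x (y : 'I_n), x < n -> rho x y = T y x :> nat,
      forall x y, x < n -> y < n -> rho (T x y) = (rho x * rho y)%g,
      forall x, x < n -> T e x = x /\ T x e = x
    & forall x, x < n -> exists2 v, v < n & T v x = e /\ T x v = e].
Proof.
move=> [T_lt T_A [e lt_e [T_e T_V]]].
(* Translation by x is known to be a permutation only for x < n; the default 1 makes [rho] total. *)
pose rho x : 'S_n := odflt 1%g [pick p : 'S_n | [forall y, p y == T y x :> nat]].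
have rhoE x (y : 'I_n) : x < n -> rho x y = T y x :> nat.
  move=> lt_x; rewrite /rho; case: pickP => [p /forallP/(_ y)/eqP//|no].
  have inj : injective (fun y : 'I_n => Ordinal (T_lt y x (ltn_ord y) lt_x)).
    move=> y1 y2 /(congr1 (@nat_of_ord _)) /= eqT; apply: val_inj => /=.
    have [v lt_v [_ Txv]] := T_V x lt_x.
    by rewrite -[LHS](T_e _ _).2 // -[RHS](T_e _ _).2 // -Txv !T_A // eqT.
  by have := no (perm inj); case/forallP => z; rewrite permE.
exists rho, (Ordinal lt_e); split=> // x y lt_x lt_y; apply/permP => z.
by apply: val_inj; rewrite /= permM !rhoE ?T_lt // T_A.
Qed.

(** The identity is found as the idempotent [e], then [v] as the inverse of t^k, and [a] is tested
    against v a t^k. All searches stay below [n]. *)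
Definition table_commutes n (T : nat -> nat -> nat) a t k : bool :=
  has (fun e => (T e e == e) && has (fun v =>
    (T (iter k (fun x => T x t) e) v == e) &&
    (T a (T v (T a (iter k (fun x => T x t) e))) ==
     T (T v (T a (iter k (fun x => T x t) e))) a)) (iota 0 n)) (iota 0 n).

Lemma table_commutesP n T (rho : nat -> 'S_n) (e : 'I_n) a t k :
  (forall x y, x < n -> y < n -> T x y < n) ->
  (forall x (y : 'I_n), x < n -> rho x y = T y x :> nat) ->
  (forall x y, x < n -> y < n -> rho (T x y) = (rho x * rho y)%g) ->
  (forall x, x < n -> T e x = x /\ T x e = x) ->
  (forall x, x < n -> exists2 v, v < n & T v x = e /\ T x v = e) ->
  a < n -> t < n ->
  table_commutes n T a t k <-> commute (rho a) (rho a ^ (rho t ^+ k))%g.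
Proof.
move=> T_lt rhoE rhoM T_e T_V lt_a lt_t.
have rho_inj x y : x < n -> y < n -> rho x = rho y -> x = y.
  move=> lt_x lt_y /permP/(_ e)/(congr1 (@nat_of_ord _)).
  by rewrite !rhoE // (T_e x lt_x).1 (T_e y lt_y).1.
have rho1 : rho e = 1%g.
  by apply/permP => y; apply: val_inj; rewrite /= perm1 rhoE // (T_e y _).2.
pose u := iter k (fun x => T x t) e.
have [lt_u rho_u] : u < n /\ rho u = (rho t ^+ k)%g.
  rewrite /u; elim: k {u} => [|k [IHlt IH]]; first by rewrite expg0 /=.
  by rewrite iterS; split; [apply: T_lt | rewrite rhoM // IH expgSr].
have conjE v : v < n -> T u v = e -> rho (T v (T a u)) = (rho a ^ (rho t ^+ k))%g.
  move=> lt_v Tuv; rewrite !rhoM ?T_lt // conjgE rho_u; congr (_ * _)%g.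
  by apply/esym/eqP; rewrite eq_invg_mul -rho_u -rhoM // Tuv rho1.
split.
  move=> /hasP[e']; rewrite mem_iota => lt_e' /andP[/eqP idem].
  have -> : e' = e.
    apply: rho_inj => //; rewrite rho1; apply: (mulgI (rho e')).
    by rewrite -rhoM // idem mulg1.
  move=> /hasP[v]; rewrite mem_iota -/u => lt_v /andP[/eqP Tuv /eqP eqT].
  by rewrite /commute -(conjE v) // -!rhoM ?T_lt // eqT.
move=> comm; apply/hasP; exists (nat_of_ord e); first by rewrite mem_iota ltn_ord.
rewrite (T_e e _).1 // eqxx; have [v lt_v [_ Tuv]] := T_V u lt_u.
apply/hasP; exists v; rewrite ?mem_iota // -/u Tuv eqxx /=; apply/eqP.
have := conjE v lt_v Tuv; have : T v (T a u) < n by rewrite !T_lt.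
move: (T v (T a u)) => w lt_w rho_w; apply: rho_inj; rewrite ?T_lt // !rhoM // rho_w.
exact: comm.
Qed.

Definition table_tame n T a t : bool :=
  all (fun j => table_commutes n T a t (expo j n)) (iota 0 n).

Lemma iter_hom k x (T : nat -> nat -> nat) (phi : tame_group -> nat) :
  (forall g h, phi (gmul g h) = T (phi g) (phi h)) ->
  iter k (fun y => T y (phi x)) (phi (gone tame_group)) =
  phi (iter k (fun y => gmul y x) (gone tame_group)).
Proof. by move=> phiM; elim: k => //= k ->; rewrite phiM. Qed.

Lemma sval_iter k (i : tame_pair) :
  sval (iter k (fun y => gmul y (tame_gens 1)) (gone tame_group)) i =
  (second_perm i ^+ k)%g.
Proof. by elim: k => //= k ->; rewrite expgSr. Qed.

(** A homomorphism carries the relations of the group over to the images of the generators.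
    Conversely, if those images form a tame pair in the regular representation, this pair is a
    coordinate of the product, and projecting to it gives the homomorphism. *)
Lemma tame_extends n tbl fl : marked_finite_group 2 n tbl fl ->
  extends_to_hom 2 tame_gens n tbl fl <->
  table_tame n (table_of n tbl) (nth 0 fl 0) (nth 0 fl 1).
Proof.
move=> [_ size_fl /allP lt_fl gtT]; set T := table_of n tbl in gtT *.
have [rho [e [rhoE rhoM T_e T_V]]] := cayley gtT; have [T_lt _ _] := gtT.
set a := nth 0 fl 0; set t := nth 0 fl 1.
have lt_a : a < n by apply/lt_fl/mem_nth; rewrite size_fl.
have lt_t : t < n by apply/lt_fl/mem_nth; rewrite size_fl.
have commP k := table_commutesP k T_lt rhoE rhoM T_e T_V lt_a lt_t.
have tameP : table_tame n T a t <-> tame (rho a) (rho t).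
  rewrite tame_bounded; split=> [/allP h j lt_j|h].
    by apply/commP/h; rewrite mem_iota.
  by apply/allP => j; rewrite mem_iota => /h/commP.
rewrite tameP; split=> [[phi [phi_lt phiM phi_s]] j N stN|tm].
  rewrite -/T in phiM.
  (* The witnesses for the table search are the images of 1 and of the inverse of t^k. *)
  apply/commP; apply/hasP; exists (phi (gone _)); first by rewrite mem_iota phi_lt.
  rewrite /a /t -(phi_s 0) // -(phi_s 1) // -phiM gmul1 eqxx /= (iter_hom _ _ phiM).
  set u := iter _ _ _; apply/hasP; exists (phi (ginv u)); first by rewrite mem_iota phi_lt.
  rewrite -!phiM gmulVr eqxx /=; apply/eqP; congr phi; apply: generated_eq.
  apply: functional_extensionality_dep => i; rewrite /= sval_iter.
  by have := @tame_pairP i _ _ stN; rewrite conjgE.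
pose i := TamePair tm.
(* The image of [rho] contains both generators at this coordinate and is closed under products and
   inverses, so it contains the value of every word. *)
have in_rho (g : tame_group) : exists2 x, x < n & sval g i = rho x.
  have rhoV x : x < n -> exists2 v, v < n & (rho x)^-1%g = rho v.
    move=> lt_x; have [v lt_v [_ Txv]] := T_V x lt_x; exists v => //.
    apply/eqP; rewrite eq_invg_mul -rhoM // Txv; apply/eqP/permP => y.
    by apply: val_inj; rewrite /= perm1 rhoE // (T_e y _).2.
  have letter_rho l : exists2 x, x < n & letter_val universal_pair l i = rho x.
    rewrite /letter_val /= /universal_pair; case: odd; case: eqP => _ /=;
      by [apply: rhoV | exists a | exists t].
  have [w [_ <-]] := generated_generates universal_pair_in g.
  rewrite generated_word; elim: w => [|l w [x lt_x IH]] /=.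
    exists (nat_of_ord e) => //; apply/esym/permP => y.
    by apply: val_inj; rewrite /= perm1 rhoE // (T_e y _).2.
  have [y lt_y ->] := letter_rho l; exists (T y x); rewrite ?T_lt // rhoM //.
  by rewrite IH.
have rho_e x : x < n -> rho x e = x :> nat by move=> lt_x; rewrite rhoE // (T_e x _).1.
(* Evaluation at the identity [e] recovers x from [rho x]. *)
exists (fun g : tame_group => nat_of_ord ((sval g i : 'S_n) e)); split=> [g|g h|k].
- exact: ltn_ord.
- have [x lt_x ex] := in_rho g; have [y lt_y ey] := in_rho h.
  by rewrite /= ex ey -rhoM // !rho_e ?T_lt.
- by case: k => [|[|k]] //= _; rewrite rho_e.
Qed.

Definition code_table n tbl x y := cnth tbl (x * n + y).

Lemma code_tableE n tbl : code_table n (code_list tbl) = table_of n tbl.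
Proof.
apply: functional_extensionality => x; apply: functional_extensionality => y.
by rewrite /code_table cnth_code.
Qed.

Lemma computable_code_table : computable4 code_table.
Proof. by rewrite /computable4 /code_table; computability. Qed.
#[local] Hint Resolve computable_code_table : computability.

Lemma tame_group_CFQ : CFQ 2 tame_gens.
Proof.
(* The test is negated because the answer 0 means yes. *)
pose check n tbl fl := ~~ table_tame n (code_table n tbl) (cnth fl 0) (cnth fl 1).
have [f hf] : computable1 (fun m => check (cnth m 0) (cnth m 1) (cnth m 2)).
  by rewrite /computable1 /check /table_tame /table_commutes; computability.
exists f => m [n [tbl [fl [mfg ->]]]].
have := hf [:: code_marked n tbl fl] erefl.
rewrite /= /code_marked !cnth_code /= /check code_tableE !cnth_code.
have ext := tame_extends mfg; case: table_tame ext => ext hrun; split=> // h.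
  by case: h; exists n, tbl, fl; split=> //; apply/ext.
exfalso; case: h => n' [tbl' [fl' [_ eqm hom]]].
(* Injectivity of the coding identifies the marked group given by the existential with the one that
   was tested. *)
case: (code_list_inj (eqm : code_marked n tbl fl = code_marked n' tbl' fl')) hom.
by move=> <- /code_list_inj <- /code_list_inj <- /ext.
Qed.

Theorem theorem2 :
  exists (G : abs_group) (d : nat) (s : nat -> G),
    [/\ generates d s, residually_finite G, CFQ d s & ~ WP_solvable d s].
Proof.
exists tame_group, 2, tame_gens; split.
- exact: generated_generates.
- exact: tame_group_residually_finite.
- exact: tame_group_CFQ.
- exact: tame_group_WP.
Qed.
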